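(* The relation algebra $4_7$ is representable over $\mathbb{Z}/n\mathbb{Z}$ for every composite $n>8$ such that $n$ is not equal to $2$ times a prime, and $\mathrm{CySp}(4_7)=\{n>8 : n \text{ is composite and } n \text{ is not twice a prime}\}$.
   Context: $4_7$ is the finite symmetric integral relation algebra with three atoms $1'$ (identity), $a$, $b$ (all symmetric, i.e. self-converse) whose mandatory diversity cycles (up to equivalence) among $aaa$, $bbb$, $abb$, $baa$ are exactly $aaa$, $bbb$ and $abb$; $baa$ is forbidden. Equivalently its composition is $a;a=1'+a$, $b;b=1'+a+b$, $a;b=b;a=b$. For a positive integer $n$, a representation of $4_7$ over the cyclic group $\mathbb{Z}/n\mathbb{Z}$ is a partition of $\mathbb{Z}/n\mathbb{Z}$ into $\mathrm{Id}=\{0\}$ and two nonempty sets $A,B$ with $A=-A$, $B=-B$, such that $A+A=A\cup\mathrm{Id}$, $B+B=A\cup B\cup\mathrm{Id}$, and $A+B=B$, where $X+Y=\{x+y : x\in X,\ y\in Y\}$ (addition modulo $n$). The algebra is representable over $\mathbb{Z}/n\mathbb{Z}$ if such a partition exists. The cyclic spectrum is $\mathrm{CySp}(4_7)=\{n : n \text{ a positive integer and } 4_7 \text{ is representable over } \mathbb{Z}/n\mathbb{Z}\}$. *)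

(* Defs.v *)
From mathcomp Require Import all_boot all_order all_algebra.
From mathcomp Require Import classical_sets.

Set Implicit Arguments.
Unset Strict Implicit.
Unset Printing Implicit Defensive.

Import GRing.Theory.
Local Open Scope ring_scope.

Definition sumset (G : finZmodType) (X Y : {set G}) : {set G} :=
  [set x + y | x in X, y in Y]%SET.

Definition oppset (G : finZmodType) (X : {set G}) : {set G} :=
  [set - x | x in X]%SET.

(* A and B represent the diversity atoms a and b, and [set 0] represents 1'.
   The partition is spelled out because finset's [partition [set [set 0]; A; B]]
   would not exclude coincidences between the three blocks. *)
Record represents_4_7 (G : finZmodType) (A B : {set G}) : Prop := {
  rep_cover : ([set 0] :|: A :|: B = [set: G])%SET;
  rep_disj0A : [disjoint [set 0%R : G]%SET & A];
  rep_disj0B : [disjoint [set 0%R : G]%SET & B];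
  rep_disjAB : [disjoint A & B];
  rep_A_neq0 : A != finset.set0;
  rep_B_neq0 : B != finset.set0;
  rep_symA : A = oppset A;
  rep_symB : B = oppset B;
  rep_AA : (sumset A A = A :|: [set 0])%SET;
  rep_BB : (sumset B B = A :|: B :|: [set 0])%SET;
  rep_AB : sumset A B = B
}.

(* For n > 0, 'I_n.-1.+1 is Z/nZ with addition modulo n, including the trivial
   group for n = 1, where 'Z_n would be Z/2Z.  The value at n = 0 is junk. *)
Definition representable_4_7 (n : nat) : Prop :=
  exists A B : {set 'I_n.-1.+1}, represents_4_7 A B.

Definition CySp_4_7 : set nat :=
  [set n | (0 < n)%N /\ representable_4_7 n]%classic.

Definition composite (n : nat) : Prop := (1 < n)%N /\ ~ prime n.

Definition twice_prime (n : nat) : Prop := exists p : nat, prime p /\ n = (2 * p)%N.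

(* Main.v *)
(** In a representation, H = A + 1' is closed under addition, hence a subgroup,
    and B is its complement.  The product a;a = 1' + a forces |H| > 2, and
    b;b containing b forces H to have index greater than 2; conversely, these two
    inequalities suffice.  In a cyclic group of order n, such a subgroup
    exists exactly when n = d * e with d, e > 2. *)
Require Import Defs.
From mathcomp Require Import classical_sets.
From mathcomp Require Import all_boot all_order all_algebra.
From mathcomp Require Import all_fingroup cyclic zify.

Set Implicit Arguments.
Unset Strict Implicit.
Unset Printing Implicit Defensive.

Import GRing.Theory FinRing.Theory.

Section SubgroupRepresentation.

Variable G : finZmodType.
Implicit Types (A B : {set G}) (H : {group G}) (x y : G).
Local Open Scope ring_scope.

(** Bridges the multiplicative notation for cosets and the additive notation of the algebra. *)
Lemma mem_rcosetB H x y : (x \in (H :* y)%g) = (x - y \in H).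
Proof. by rewrite mem_rcoset. Qed.

Lemma card_subgroupU_rcoset H x :
  (#|(H :|: (H :* x)%g)%SET| <= 2 * #|H|)%N.
Proof.
by rewrite cardsU card_rcoset mul2n -addnn leq_subr.
Qed.

Lemma card_subgroupU_rcoset_notin H x :
  x \notin H -> #|(H :|: (H :* x)%g)%SET| = (2 * #|H|)%N.
Proof.
move=> xH; rewrite cardsU card_rcoset (_ : (_ :&: _)%SET = finset.set0).
  by rewrite cards0 subn0 mul2n addnn.
apply/finset.setP=> y; rewrite !inE mem_rcosetB.
apply/negP=> /andP[yH yxH]; case/negP: xH.
by rewrite -[x](subKr y) -!zmodVgE -zmodMgE groupM ?groupV.
Qed.

Lemma subgroup_represents_4_7 H :
  (2 < #|H|)%N -> (2 * #|H| < #|G|)%N ->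
  represents_4_7 (H :\ (0 : G))%SET (~: H)%SET.
Proof.
move=> H_gt2 H_ltG.
have H0 : 0 \in H := group1 H.
have HD x y : x \in H -> y \in H -> x + y \in H by exact: groupM.
have HN x : (- x \in H) = (x \in H) by exact: groupV.
have HDr x y : y \in H -> (x + y \in H) = (x \in H) by exact: groupMr.
(* The two cosets [H] and [H + x] cannot cover [G]. A [y] outside both writes any [x] as
   [y + (x - y)] with both summands outside [H], which gives the product b;b. *)
have outside x : exists2 y, y \notin H & y - x \notin H.
  have : ~~ ([set: G] \subset (H :|: (H :* x)%g))%SET.
    apply: contraL H_ltG => /subset_leq_card; rewrite cardsT -leqNgt => le.
    exact: leq_trans le (card_subgroupU_rcoset H x).
  case/subsetPn=> y _; rewrite !inE negb_or mem_rcosetB => /andP[yH yxH].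
  by exists y.
(* Since [H] has a third element besides 0 and [x], every [x] in [H] is [y + (x - y)] with both
   summands nonzero in [H]. *)
have inside x : exists2 y, y \in H & (y != 0) && (y != x).
  have : ~~ (H \subset [set 0; x])%SET.
    apply: contraL H_gt2 => /subset_leq_card le; rewrite -leqNgt.
    by apply: leq_trans le _; rewrite cards2; case: eqP.
  by case/subsetPn=> y yH; rewrite !inE negb_or; exists y.
split.
- by apply/finset.setP=> x; rewrite !inE; case: eqP => //=; case: (x \in H).
- by rewrite disjoints_subset; apply/fintype.subsetP=> x; rewrite !inE => ->.
- rewrite disjoints_subset; apply/fintype.subsetP=> x.
  by rewrite !inE => /eqP->; rewrite H0.
- by rewrite disjoints_subset; apply/fintype.subsetP=> x; rewrite !inE negbK => /andP[].
- have [y yH /andP[y0 _]] := inside 0.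
  by apply/set0Pn; exists y; rewrite !inE y0.
- have [y yH _] := outside 0.
  by apply/set0Pn; exists y; rewrite inE.
- apply/finset.setP=> x; apply/idP/imsetP.
    by exists (- x); rewrite ?opprK // !inE oppr_eq0 HN -in_setD1.
  by case=> y yA ->; move: yA; rewrite !inE oppr_eq0 HN.
- apply/finset.setP=> x; apply/idP/imsetP.
    by exists (- x); rewrite ?opprK // !inE HN -in_setC.
  by case=> y yA ->; move: yA; rewrite !inE HN.
- apply/finset.setP=> x; apply/imset2P/idP.
    case=> y z; rewrite !inE => /andP[_ yH] /andP[_ zH] ->.
    by rewrite HD // andbT orNb.
  rewrite !inE => xH0; have xH : x \in H by case: eqP xH0 => [->|_ /orP[]].
  have [y yH /andP[y0 yx]] := inside x.
  exists y (x - y); rewrite ?inE ?y0 ?yH //; last by rewrite addrC subrK.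
  by rewrite subr_eq0 eq_sym yx HDr // HN.
- apply/finset.setP=> x; apply/imset2P/idP.
    by rewrite !inE; case: eqP; case: (x \in H).
  move=> _; have [y yH yxH] := outside x.
  exists y (x - y); rewrite ?inE //; first by rewrite -HN opprB.
  by rewrite addrC subrK.
- apply/finset.setP=> x; apply/imset2P/idP.
    case=> y z; rewrite !inE => /andP[_ yH] zH ->.
    by rewrite addrC HDr.
  rewrite inE => xH.
  have [y yH /andP[y0 _]] := inside 0.
  exists y (x - y); rewrite ?inE ?y0 //; last by rewrite addrC subrK.
  by rewrite HDr // HN.
Qed.

Lemma represents_4_7_subgroup A B :
  represents_4_7 A B ->
  exists2 H : {group G}, (2 < #|H|)%N & (2 * #|H| < #|G|)%N.
Proof.
case=> cov d0A d0B dAB A0 B0 _ symB AA BB _.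
have A_0 : 0 \notin A by rewrite -disjoints1.
have memAA x y : x \in A -> y \in A -> (x + y \in A) || (x + y == 0).
  move=> xA yA; have : x + y \in sumset A A by apply: imset2_f.
  by rewrite AA !inE.
(* In a finite group, containing 0 and being closed under addition is enough. *)
have gH : group_set (0 |: A)%SET.
  apply/group_setP; split=> [|x y]; first by rewrite !inE eqxx.
  rewrite zmodMgE !inE => /predU1P[->|xA] /predU1P[->|yA].
  - by rewrite addr0 eqxx.
  - by rewrite add0r yA orbT.
  - by rewrite addr0 xA orbT.
  - by rewrite orbC memAA.
pose H := Group gH.
have HB x : (x \in H) = (x \notin B).
  have := in_setT x; rewrite -cov !inE.
  case: (boolP (x \in B)) => [xB _|_]; last by rewrite orbF.
  rewrite (disjointFl dAB) // orbF.
  by apply: contraTF xB => /eqP->; rewrite -disjoints1.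
exists H.
  (* Write [a = x + y] inside [A]. As [y] is nonzero, [x] differs from [a], so 0, [a] and [x] are
     three elements of [H]. *)
  have [a aA] := set0Pn _ A0.
  have : a \in sumset A A by rewrite AA inE aA.
  case/imset2P=> x y xA yA axy.
  have xa : x != a.
    apply: contraNneq A_0 => xa; suff <- : y = 0 by [].
    by apply: (addrI x); rewrite -axy addr0.
  rewrite cardsU1 A_0 (cardsD1 a) aA (cardsD1 x) !inE xa xA; lia.
(* Write [b = x + y] inside [B]. Then [H] and [H + x] are disjoint, and [b] lies in neither because
   [b - x = y] is in [B]; hence the index exceeds 2. *)
have [b bB] := set0Pn _ B0.
have : b \in sumset B B by rewrite BB !inE bB orbT.
case/imset2P=> x y xB yB bxy.
rewrite -(@card_subgroupU_rcoset_notin _ x) ?HB ?xB //.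
rewrite -cardsT proper_card // properE finset.subsetT.
apply/subsetPn; exists b; first exact: in_setT.
rewrite in_setU negb_or mem_rcosetB.
have -> : (b - x = y)%R by rewrite bxy addrC addKr.
by rewrite !HB bB negbK yB.
Qed.

End SubgroupRepresentation.

Lemma Zp_subgroup_card n d : (d %| n.+1)%N ->
  exists H : {group 'I_n.+1}, #|H| = d.
Proof.
(* The generator 1 has order [n.+1], so its multiple by [n.+1 %/ d] has order [d]. *)
move=> dn; exists <[Zp1 ^+ (n.+1 %/ d)]>%G.
by rewrite -orderE orderXdiv ?order_Zp1 ?dvdn_div // divnA // mulKn.
Qed.

Lemma representable_4_7P n : (0 < n)%N ->
  representable_4_7 n <->
  exists d e, [/\ n = (d * e)%N, (2 < d)%N & (2 < e)%N].
Proof.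
case: n => // n _; rewrite /representable_4_7 /=; split.
  case=> A [B /represents_4_7_subgroup[H H_gt2 H_lt]].
  have := cardSg (finset.subsetT H); rewrite cardsT => /dvdnP[e].
  move: H_lt; rewrite card_ord => H_lt nE.
  by exists #|H|, e; split=> //; nia.
case=> d [e [nE d_gt2 e_gt2]].
have [|H HE] := @Zp_subgroup_card n d; first by rewrite nE dvdn_mulr.
exists (H :\ (0%R : 'I_n.+1))%SET, (~: H)%SET.
apply: subgroup_represents_4_7; rewrite HE // card_ord nE.
nia.
Qed.

Lemma composite_not_twice_primeP n :
  [/\ (8 < n)%N, composite n & ~ twice_prime n] <->
  exists d e, [/\ n = (d * e)%N, (2 < d)%N & (2 < e)%N].
Proof.
split=> [[n_gt8 [_ /negP/primePns n_np] n_n2p]|[d [e [-> d_gt2 e_gt2]]]].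
  case: n_np => [|[p [p_pr p2n /dvdnP[m nE]]]]; first by lia.
  have p_gt1 := prime_gt1 p_pr.
  (* From [p ^ 2 <= n = m * p] follows [m >= p], so an odd [p] already gives the factorization. *)
  have [p_gt2|p_le2] := ltnP 2 p; first by exists m, p; split=> //; nia.
  have p2 : p = 2 by lia.
  have /negP/primePns m_np : ~ prime m.
    by move=> m_pr; apply: n_n2p; exists m; rewrite nE p2 mulnC.
  case: m_np => [|[q [q_pr q2m /dvdnP[r mE]]]]; first by lia.
  have q_gt1 := prime_gt1 q_pr.
  (* Here [n = 2 * m] with [m = r * q] and [r >= q >= 2]. If [r] were 2, then [q = 2] and [n = 8],
     against [n > 8]. *)
  by exists r, (2 * q)%N; split; nia.
split; first by nia.
  split; first by nia.
  apply/negP/primePn; right.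
  by exists d; [nia | exact: dvdn_mulr].
(* The prime [p] divides [d] or [e]; cancelling it from [d * e = 2 * p] leaves the other factor,
   which exceeds 2, as a divisor of 2. *)
case=> p [p_pr deE].
have : p %| d * e by rewrite deE dvdn_mull.
have p_gt0 := prime_gt0 p_pr.
rewrite Euclid_dvdM // => /orP[] /dvdnP[k kE].
  have : (k * e)%N == 2 by rewrite -(eqn_pmul2r p_gt0) -deE kE mulnAC.
  by case: k {kE} => [|k] /eqP; nia.
have : (d * k)%N == 2 by rewrite -(eqn_pmul2r p_gt0) -deE kE mulnA.
by case: k {kE} => [|k] /eqP; nia.
Qed.

Theorem theorem7 :
  (forall n : nat,
     composite n -> (8 < n)%N -> ~ twice_prime n -> representable_4_7 n) /\
  CySp_4_7 =
    [set n : nat | (8 < n)%N /\ composite n /\ ~ twice_prime n]%classic.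
Proof.
have spectrumP n : (0 < n)%N -> representable_4_7 n <->
    [/\ (8 < n)%N, composite n & ~ twice_prime n].
  by move=> n_gt0; rewrite representable_4_7P // composite_not_twice_primeP.
split=> [n n_comp n_gt8 n_n2p|]; first by apply/spectrumP => //; lia.
apply/seteqP; split=> n /=.
  by case=> n_gt0 /(spectrumP n n_gt0)[].
case=> n_gt8 [n_comp n_n2p]; have n_gt0 : (0 < n)%N by lia.
by split=> //; apply/spectrumP.
Qed.
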